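(* Let $f\in l^\infty(\mathbb{N})$ be asymptotically periodic, let $\mathcal{A}_f$ be the unital C*-subalgebra of $l^\infty(\mathbb{N})$ generated by $\{1\}\cup\{A^jf:j\in\mathbb{N}\}$, $X_f$ its maximal ideal space and $\sigma_A:X_f\to X_f$, $\sigma_A(\rho)(g)=\rho(Ag)$. Let $E$ be a mean state and $\nu$ the unique $\sigma_A$-invariant Borel probability measure on $X_f$ with $E(g)=\int_{X_f}\gamma(g)\,d\nu$ for all $g\in\mathcal{A}_f$. Then $(X_f,\nu,\sigma_A)$ is rigid: there is a sequence $(n_j)$ of positive integers such that $\lim_{j\to\infty}\|F\circ\sigma_A^{n_j}-F\|_{L^2(\nu)}=0$ for every $F\in L^2(X_f,\nu)$ (equivalently, $\nu(\sigma_A^{-n_j}B\,\triangle\,B)\to0$ for every Borel set $B$).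
   Context: $(Af)(n)=f(n+1)$; $\gamma$ is the Gelfand transform $\gamma(g)(\rho)=\rho(g)$. A mean state is a functional $E_\omega(f)=\lim_{n\to\omega}\frac1n\sum_{j=0}^{n-1}f(j)$ with $\omega$ a free ultrafilter on $\mathbb{N}$; it is $A$-invariant, so its restriction to $\mathcal{A}_f$ induces such a measure $\nu$. $\|f\|_E=E(|f|^2)^{1/2}$; $f$ is asymptotically periodic if for every mean state $E$ there is a sequence $(n_j)$ of positive integers with $\|f-A^{n_j}f\|_E\to0$. *)

(* Defs.v *)
From HB Require Import structures.
From mathcomp Require Import all_boot all_order all_algebra complex.
From mathcomp Require Import all_classical all_reals all_analysis.

Set Implicit Arguments.
Unset Strict Implicit.
Unset Printing Implicit Defensive.

Import Order.TTheory GRing.Theory Num.Theory.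
Import numFieldNormedType.Exports.

Local Open Scope classical_set_scope.
Local Open Scope ring_scope.

Notation normc := ComplexField.Normc.normc.

(* Sequences live in [nat -> R[i]], which carries the pointwise ring and
   module structures; l^oo is a subset of it. *)
Definition linfty (R : realType) : set (nat -> R[i]) :=
  [set g | exists M : R, forall n, normc (g n) <= M].

Definition supnorm (R : realType) (g : nat -> R[i]) : R :=
  sup [set normc (g n) | n in [set: nat]].

Definition shift (R : realType) (g : nat -> R[i]) : nat -> R[i] :=
  fun n => g n.+1.

Record unital_cstar_subalgebra (R : realType) (S : set (nat -> R[i])) : Prop :=
  UnitalCstarSubalgebra {
    cstar_bounded : S `<=` @linfty R ;
    cstar_one : S 1 ;
    cstar_add : forall g h, S g -> S h -> S (g + h) ;
    cstar_scale : forall (a : R[i]) g, S g -> S (a *: g) ;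
    cstar_mul : forall g h, S g -> S h -> S (g * h) ;
    cstar_conj : forall g, S g -> S (fun n => (g n)^*) ;
    cstar_closed : forall g, linfty g ->
      (forall e : R, 0 < e -> exists2 h, S h & supnorm (g - h) < e) -> S g }.

Definition cstar_generated (R : realType) (G : set (nat -> R[i])) :
    set (nat -> R[i]) :=
  \bigcap_(S in [set S | unital_cstar_subalgebra S /\ G `<=` S]) S.

(* [shift_algebra f] below is the C*-algebra generated by 1 and this orbit. *)
Definition shift_orbit (R : realType) (f : nat -> R[i]) : set (nat -> R[i]) :=
  [set iter j (@shift R) f | j in [set: nat]].

Definition in_shift_algebra (R : realType) (f : nat -> R[i]) :
    pred (nat -> R[i]) :=
  fun g => `[< cstar_generated ([set 1] `|` shift_orbit f) g >].

Section shift_algebra.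
Variables (R : realType) (f : nat -> R[i]).
Local Notation P := (in_shift_algebra f).

Lemma in_shift_algebraP (g : nat -> R[i]) :
  reflect (forall S, unital_cstar_subalgebra S ->
             [set 1] `|` shift_orbit f `<=` S -> S g) (P g).
Proof.
apply: (iffP (asboolP _)) => [H S cS GS|H S [cS GS]]; last exact: H.
exact: (H S).
Qed.

Fact in_shift_algebra_subring : subring_closed P.
Proof.
split.
- by apply/in_shift_algebraP => S cS _; exact: cstar_one.
- move=> g h /in_shift_algebraP Pg /in_shift_algebraP Ph.
  apply/in_shift_algebraP => S cS GS; apply: cstar_add => //; first exact: Pg.
  rewrite -scaleN1r; apply: cstar_scale => //; exact: Ph.
- move=> g h /in_shift_algebraP Pg /in_shift_algebraP Ph.
  apply/in_shift_algebraP => S cS GS.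
  by apply: cstar_mul => //; [exact: Pg|exact: Ph].
Qed.

Fact in_shift_algebra_scale : GRing.scaler_closed P.
Proof.
move=> a g /in_shift_algebraP Pg; apply/in_shift_algebraP => S cS GS.
by apply: cstar_scale => //; exact: Pg.
Qed.

HB.instance Definition _ :=
  GRing.isSubringClosed.Build (nat -> R[i]) P in_shift_algebra_subring.
HB.instance Definition _ :=
  GRing.isScaleClosed.Build R[i] (nat -> R[i]) P in_shift_algebra_scale.

Record shift_algebra := ShiftAlgebra {
  seq_of : nat -> R[i] ;
  seq_ofP : P seq_of }.

HB.instance Definition _ := [isSub for seq_of].
HB.instance Definition _ := [Choice of shift_algebra by <:].
HB.instance Definition _ :=
  [SubChoice_isSubComNzRing of shift_algebra by <:].
HB.instance Definition _ :=
  [SubZmodule_isSubLmodule of shift_algebra by <:].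

End shift_algebra.

Fact in_shift_algebra_shift (R : realType) (f g : nat -> R[i]) :
  in_shift_algebra f g -> in_shift_algebra f (shift g).
Proof.
move=> /in_shift_algebraP Pg; apply/in_shift_algebraP => S cS GS.
pose T := [set h | S h /\ S (shift h)].
suff cT : unital_cstar_subalgebra T.
  apply: (Pg T cT _).2 => h [->|[j _ <-]].
    by split; exact: (cstar_one cS).
  split; apply: GS; right; first by exists j.
  by exists j.+1.
split.
- by move=> h [/(cstar_bounded cS)].
- by split; exact: (cstar_one cS).
- move=> h k [Sh Sh'] [Sk Sk'].
  by split; [exact: (cstar_add cS)|exact: (cstar_add cS Sh' Sk')].
- move=> a h [Sh Sh'].
  by split; [exact: (cstar_scale cS)|exact: (cstar_scale cS a Sh')].
- move=> h k [Sh Sh'] [Sk Sk'].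
  by split; [exact: (cstar_mul cS)|exact: (cstar_mul cS Sh' Sk')].
- move=> h [Sh Sh'].
  by split; [exact: (cstar_conj cS)|exact: (cstar_conj cS Sh')].
- move=> h [M hM] Hh; split.
    apply: (cstar_closed cS); first by exists M.
    by move=> e /Hh [k [Sk _] ?]; exists k.
  apply: (cstar_closed cS); first by exists M => n; exact: hM.
  move=> e /Hh [k [Sk Sk'] ke]; exists (shift k) => //.
  have [N kN] := cstar_bounded cS Sk.
  apply: le_lt_trans ke; apply: sup_le.
  - move=> _ [n _ <-]; by apply: le_down; exists n.+1.
  - by exists (normc ((shift h - shift k) 0%N)), 0%N.
  - split; first by exists (normc ((h - k) 0%N)), 0%N.
    exists (M + N) => _ [n _ <-].
    apply: le_trans (le_normcD (h n) (- k n)) _.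
    by rewrite normcN lerD.
Qed.

Definition shift_alg (R : realType) (f : nat -> R[i]) (g : shift_algebra f) :
    shift_algebra f :=
  ShiftAlgebra (in_shift_algebra_shift (seq_ofP g)).

(* Maximal ideals of a commutative unital C*-algebra are identified with its
   characters; pointwise convergence on the algebra is the weak-* topology. *)
Definition is_character (R : realType) (f : nat -> R[i])
    (rho : shift_algebra f -> R[i]^o) : Prop :=
  [/\ linear rho,
      forall g h, rho (g * h) = rho g * rho h
    & exists g, rho g != 0].

Definition spectrum (R : realType) (f : nat -> R[i]) : Type :=
  set_type [set rho : {ptws shift_algebra f -> R[i]^o} | is_character rho].

HB.instance Definition _ (R : realType) (f : nat -> R[i]) :=
  Topological.on (spectrum f).

Section spectrum.
Variables (R : realType) (f : nat -> R[i]).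

Definition eval_char (rho : spectrum f) : shift_algebra f -> R[i] :=
  set_val rho.

Fact is_character_eval0 :
  is_character (fun g : shift_algebra f => seq_of g 0%N : R[i]^o).
Proof. by split => //; exists 1; rewrite oner_eq0. Qed.

HB.instance Definition _ := isPointed.Build (spectrum f)
  (SigSub (mem_set is_character_eval0)).

Definition gelfand (g : shift_algebra f) : spectrum f -> R[i] :=
  fun rho => eval_char rho g.

Fact is_character_shift (rho : spectrum f) :
  is_character (fun g => eval_char rho (shift_alg g) : R[i]^o).
Proof.
have [rhoL rhoM [g rhog]] := set_valP rho.
split.
- move=> a h k; rewrite /eval_char -rhoL; congr (set_val rho _).
  exact: val_inj.
- move=> h k; rewrite /eval_char -rhoM; congr (set_val rho _).
  exact: val_inj.
- exists 1; rewrite (_ : shift_alg 1 = 1); last exact: val_inj.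
  apply: contraNneq rhog => rho1; rewrite -[g]mul1r rhoM.
  exact/eqP/(etrans (congr1 ( *%R^~ _) rho1))/mul0r.
Qed.

Definition sigma (rho : spectrum f) : spectrum f :=
  SigSub (mem_set (is_character_shift rho)).

Definition borel_spectrum := g_sigma_algebraType (@open (spectrum f)).

End spectrum.

Definition free_ultrafilter (w : set_system nat) : Prop :=
  UltraFilter w /\ \bigcap_(S in w) S = set0.

Definition average (R : realType) (g : nat -> R[i]) : nat -> R[i]^o :=
  fun n => n%:R^-1 * \sum_(0 <= j < n) g j.

(* [lim] is total; on bounded sequences the averages do converge along any
   ultrafilter, so that only the values outside l^oo are meaningless. *)
Definition mean_along (R : realType) (w : set_system nat) (g : nat -> R[i]) :
    R[i] :=
  lim (average g @ w).

Definition mean_state (R : realType) (E : (nat -> R[i]) -> R[i]) : Prop :=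
  exists2 w, free_ultrafilter w & E = mean_along w.

Definition mean_seminorm (R : realType) (E : (nat -> R[i]) -> R[i])
    (g : nat -> R[i]) : R[i] :=
  sqrtC (E (fun n => `|g n| ^+ 2)).

Definition asymptotically_periodic (R : realType) (f : nat -> R[i]) : Prop :=
  forall E, mean_state E ->
  exists n_ : nat -> nat, (forall j, (0 < n_ j)%N) /\
    (mean_seminorm E (f - iter (n_ j) (@shift R) f) : R[i]^o)
      @[j --> \oo] --> (0 : R[i]^o).

Section dynamics.
Context d (T : measurableType d) (R : realType).
Variables (mu : {measure set T -> \bar R}) (s : T -> T).

Definition complex_integral (F : T -> R[i]) : R[i] :=
  Complex (\int[mu]_x complex.Re (F x))
          (\int[mu]_x complex.Im (F x)).

Definition invariant_measure : Prop :=
  forall B, measurable B -> mu (s @^-1` B) = mu B.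

Definition L2norm (F : T -> R[i]) : \bar R :=
  ('N[mu]_2%:E[EFin \o (@normc R \o F)])%E.

Definition L2 : set (T -> R[i]) :=
  [set F | [/\ measurable_fun setT (fun x => complex.Re (F x)),
               measurable_fun setT (fun x => complex.Im (F x))
             & (L2norm F < +oo)%E]].

Definition L2_rigid_along (n_ : nat -> nat) : Prop :=
  forall F, L2 F ->
  L2norm (fun x => F (iter (n_ j) s x) - F x) @[j --> \oo] --> 0%E.

Definition set_rigid_along (n_ : nat -> nat) : Prop :=
  forall B, measurable B ->
  mu ((iter (n_ j) s @^-1` B) `+` B) @[j --> \oo] --> 0%E.

Definition rigid : Prop :=
  exists n_ : nat -> nat, (forall j, (0 < n_ j)%N) /\ L2_rigid_along n_.

End dynamics.

(* Main.v *)
(** Along the sequence [n_ j] given by asymptotic periodicity, the Gelfand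
    transform of [f] satisfies [|gamma f \o sigma^n_j - gamma f|_2 -> 0], since
    characters of [shift_algebra f] are *-preserving and [E] is represented by
    [nu]; by invariance the same holds for all [A^i f].  Hence the half-spaces
    [{+- Re gamma (A^i f) > a}] and [{+- Im gamma (A^i f) > a}] are rigid along
    [n_], i.e. [nu] of the symmetric difference of [B] and [sigma^-n_j B] tends
    to 0.  For measure-preserving maps the rigid sets form a sigma-algebra, and
    since the topology of the spectrum is already generated by the countably
    many functions [gamma (A^i f)], this sigma-algebra contains all Borel sets.
    Rigidity of all sets passes to [L^2] because simple functions are dense and
    the maps [F |-> F \o sigma^n_j - F] are uniformly bounded. *)

Require Import Defs.
From HB Require Import structures.
From mathcomp Require Import all_boot all_order all_algebra complex.
From mathcomp Require Import all_classical all_reals all_analysis.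
From mathcomp Require Import measurable_realfun.
From mathcomp Require Import ring lra.

Set Implicit Arguments.
Unset Strict Implicit.
Unset Printing Implicit Defensive.

Import Order.TTheory GRing.Theory Num.Theory.
Import numFieldNormedType.Exports.
Import ComplexField.Normc.

Local Open Scope classical_set_scope.
Local Open Scope ring_scope.

(** * Convergence to zero of nonnegative extended real sequences *)

Lemma nneseq_cvg0P (R : realType) (u : nat -> \bar R) :
  (forall n, (0 <= u n)%E) ->
  u n @[n --> \oo] --> 0%E <->
  (forall e : R, 0 < e -> \forall n \near \oo, (u n <= e%:E)%E).
Proof.
move=> u0; split=> [ul e e0|ule].
  have : nbhs (0%R%:E : \bar R) [set x | (x < e%:E)%E].
    apply: open_nbhs_nbhs; split; last by rewrite /= lte_fin.
    exact: open_ereal_lt_ereal.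
  by move=> /ul ue; near do apply: ltW.
move=> A [e /= e0 eA]; suff : \forall n \near \oo, A (u n) by [].
near=> n.
(* Half the radius turns the non-strict bound into membership in the open ball. *)
have une : (u n <= (e / 2)%:E)%E by near: n; apply: ule; rewrite divr_gt0.
have := u0 n; move: une; case: (u n) => [r|//|//]; rewrite !lee_fin => re r0.
apply: eA => /=; rewrite sub0r normrN ger0_norm //.
by apply: le_lt_trans re _; rewrite ltr_pdivrMr // ltr_pMr // ltr1n.
Unshelve. all: by end_near. Qed.

(** * Sequences of measure-preserving maps *)

Section measure_preserving.
Context d (T : measurableType d) (R : realType) (mu : probability T R).

(** Change of variables: the push-forward of [mu] along [s] agrees with [mu] on measurable sets. *)
Lemma ge0_integral_preserving (s : T -> T) (h : T -> \bar R) :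
  measurable_fun setT s ->
  (forall B, measurable B -> mu (s @^-1` B) = mu B) ->
  measurable_fun setT h -> (forall x, (0 <= h x)%E) ->
  (\int[mu]_x h (s x) = \int[mu]_x h x)%E.
Proof.
move=> ms mus mh h0.
have := @ge0_integral_pushforward _ _ _ _ _ s ms mu setT h measurableT mh
  (fun x _ => h0 x).
rewrite preimage_setT => <-.
by apply: eq_measure_integral => A mA _; exact: mus.
Qed.

(** Markov's inequality for the square of [h] at level [e ^+ 2]. *)
Lemma ge0_sqr_chebyshev (h : T -> R) (e : R) :
  0 < e -> measurable_fun setT h ->
  ((e ^+ 2)%:E * mu [set x : T | (e <= `|h x|)%R] <=
   \int[mu]_x ((h x) ^+ 2)%:E)%E.
Proof.
move=> e0 mh.
have mh2 : measurable_fun setT (fun x => (h x) ^+ 2).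
  exact: measurable_funX.
have mh2E : measurable_fun setT (fun x => (h x ^+ 2)%:E).
  exact/measurable_EFinP.
have e20 : 0 < e ^+ 2 by rewrite exprn_gt0.
have := @le_integral_comp_abse _ _ _ mu setT measurableT
  (fun x => ((h x) ^+ 2)%:E) (e ^+ 2) id (@measurable_id _ _ _)
  (fun _ => id) (fun x y _ _ => id)
  mh2E e20.
rewrite setTI /= (_ : [set x | _] = [set x | e <= `|h x|]).
  move=> /le_trans; apply.
  by under eq_integral do rewrite ger0_norm ?sqr_ge0 //.
apply/funext => x; apply/propext; rewrite /= lee_fin ger0_norm ?sqr_ge0 //.
by rewrite -(real_normK (num_real (h x))) (@ler_pXn2r _ 2) // nnegrE // ltW.
Qed.

Variable t : nat -> T -> T.
Hypothesis mt : forall j, measurable_fun setT (t j).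
Hypothesis mut : forall j B, measurable B -> mu (t j @^-1` B) = mu B.

(** Measurability is built in so that these sets form a sigma-algebra on their own. *)
Definition rigid_set (B : set T) : Prop :=
  measurable B /\ mu ((t j @^-1` B) `+` B) @[j --> \oo] --> 0%E.

Lemma measurable_preim j (B : set T) :
  measurable B -> measurable (t j @^-1` B).
Proof. by move=> mB; rewrite -[_ @^-1` _]setTI; exact: mt. Qed.

Lemma measurable_preimY j (B : set T) :
  measurable B -> measurable ((t j @^-1` B) `+` B).
Proof.
move=> mB; have mtB := measurable_preim j mB.
by apply: measurableU; exact: measurableD.
Qed.

Lemma rigid_setP (B : set T) : measurable B ->
  rigid_set B <-> forall e : R, 0 < e ->
    \forall j \near \oo, (mu ((t j @^-1` B) `+` B) <= e%:E)%E.
Proof.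
move=> mB; rewrite -nneseq_cvg0P //.
by split => // -[].
Qed.

(** Complementing both sets leaves a symmetric difference unchanged. *)
Lemma rigid_setC (B : set T) : rigid_set B -> rigid_set (~` B).
Proof.
move=> [mB rB]; split; first exact: measurableC.
suff -> : (fun j => mu (t j @^-1` (~` B) `+` ~` B)) =
          (fun j => mu (t j @^-1` B `+` B)) by [].
apply/funext => j; congr (mu _); rewrite /setY !setDE -preimage_setC !setCK.
by rewrite [X in X `|` _]setIC [X in _ `|` X]setIC setUC.
Qed.

Lemma rigid_setU (A B : set T) :
  rigid_set A -> rigid_set B -> rigid_set (A `|` B).
Proof.
move=> [mA /nneseq_cvg0P rA] [mB /nneseq_cvg0P rB].
apply/rigid_setP; first exact: measurableU.
move=> e e0; near=> j.
have Ae : (mu ((t j @^-1` A) `+` A) <= (e / 2)%:E)%E.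
  by near: j; apply: rA => //; rewrite divr_gt0.
have Be : (mu ((t j @^-1` B) `+` B) <= (e / 2)%:E)%E.
  by near: j; apply: rB => //; rewrite divr_gt0.
rewrite [e]splitr EFinD; apply: le_trans (leeD Ae Be).
apply: le_trans (measureU2 _ _ _); [|exact: measurable_preimY..].
apply: le_measure; rewrite ?inE.
- by apply: measurable_preimY; exact: measurableU.
- by apply: measurableU; exact: measurable_preimY.
by move=> x; rewrite /setY /= ; tauto.
Unshelve. all: by end_near. Qed.

(** The symmetric difference for [B] is covered by the one for [A], by [B \ A] and by the preimage
    of [B \ A]. Invariance gives the last two the same measure, so each piece costs at most a third
    of [e]. *)
Lemma rigid_set_approx (B : set T) : measurable B ->
  (forall e : R, 0 < e ->
     exists A, [/\ rigid_set A, A `<=` B & (mu (B `\` A) <= e%:E)%E]) ->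
  rigid_set B.
Proof.
move=> mB BA; apply/rigid_setP => // e e0.
have [|A [rA AB Ae]] := BA (e / 3); first by rewrite divr_gt0.
have [mA /nneseq_cvg0P rA'] := rA; near=> j.
have jAe : (mu ((t j @^-1` A) `+` A) <= (e / 3)%:E)%E.
  by near: j; apply: rA' => //; rewrite divr_gt0.
have mBA : measurable (B `\` A) by exact: measurableD.
have mtA := measurable_preimY j mA.
have mtBA := measurable_preim j mBA.
rewrite (_ : e = e / 3 + (e / 3 + e / 3)); last by field.
rewrite !EFinD; apply: le_trans (leeD jAe (leeD Ae Ae)).
rewrite -[X in (_ <= _ + (_ + X))%E](mut j mBA).
apply: le_trans (leeD2l _ (measureU2 _ mBA mtBA)).
apply: le_trans (measureU2 _ mtA (measurableU _ _ mBA mtBA)).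
apply: le_measure; rewrite ?inE.
- exact: measurable_preimY.
- by apply: measurableU => //; exact: measurableU.
move=> x; rewrite /setY /=.
have [Ax|Ax] := pselect (A x); have [Atx|Atx] := pselect (A (t j x));
  try (have := AB _ Ax); try (have := AB _ Atx); tauto.
Unshelve. all: by end_near. Qed.

(** Finite unions [G n] are rigid and exhaust the whole union. Since [mu] is finite, continuity from
    above makes the remainder small, and approximation from inside applies. *)
Lemma rigid_set_bigcup (F : nat -> set T) :
  (forall n, rigid_set (F n)) -> rigid_set (\bigcup_n F n).
Proof.
move=> rF; have mF n : measurable (F n) by case: (rF n).
have mUF : measurable (\bigcup_n F n) by exact: bigcup_measurable.
pose G n := \big[setU/set0]_(i < n) F i.
have rG n : rigid_set (G n).
  rewrite /G; elim: n => [|n IHn].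
    2: by rewrite big_ord_recr; exact: rigid_setU.
  rewrite big_ord0; apply/rigid_setP => // e e0; apply: nearW => j.
  by rewrite preimage_set0 setYK measure0 lee_fin ltW.
have mG n : measurable (G n) by case: (rG n).
have GF n : G n `<=` \bigcup_n F n.
  by rewrite /G -bigcup_mkord => x [i _ Fx]; exists i.
apply: rigid_set_approx => // e e0.
have : mu (\bigcup_n F n `\` G n) @[n --> \oo] --> 0%E.
  have D0 : \bigcap_n (\bigcup_n F n `\` G n) = set0.
    apply/seteqP; split => // x xD; have [[i _ Fix] _] := xD 0%N I.
    (* [G n] collects the indices below [n], so a point of [F i] first has to appear in [G i.+1]. *)
    have [_] := xD i.+1 I; apply; rewrite /G -bigcup_mkord.
    by exists i => //=.
  rewrite -(measure0 mu) -D0; apply: nonincreasing_cvg_mu.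
  - by rewrite (le_lt_trans (probability_le1 _ _)) ?ltry //; exact: measurableD.
  - by move=> i; exact: measurableD.
  - by rewrite D0.
  - move=> m n mn; apply/subsetPset => x [Fx nGx]; split => //.
    apply: contra_not nGx.
    rewrite /G -!bigcup_mkord => -[i /= im Fix]; exists i => //=.
    exact: leq_trans im mn.
move=> /nneseq_cvg0P /(_ e e0) [] // n _ /(_ n (leqnn n)) Gn.
by exists (G n).
Qed.

Lemma rigid_set_sigma_algebra : sigma_algebra setT rigid_set.
Proof.
split.
- apply/rigid_setP => // e e0; apply: nearW => j.
  by rewrite preimage_set0 setYK measure0 lee_fin ltW.
- by move=> A rA; rewrite setTD; exact: rigid_setC.
- exact: rigid_set_bigcup.
Qed.

(** * Mean-square deviations along the maps *)

(** Left without the square root, so that real and imaginary parts of a complex function simply add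
    up. *)
Definition sqdev (h : T -> R) (j : nat) : \bar R :=
  (\int[mu]_x ((h (t j x) - h x) ^+ 2)%:E)%E.

Lemma sqdev_ge0 h j : (0 <= sqdev h j)%E.
Proof. by apply: integral_ge0 => x _; rewrite lee_fin sqr_ge0. Qed.

(** A point of the half-space whose image under [t j] falls outside it either has its value in a
    thin strip just above [a], or moves by at least the width of that strip. The strip has small
    measure by its choice, the large moves by Chebyshev for large [j]. *)
Lemma sqdev_gt_rigid (h : T -> R) (a : R) :
  measurable_fun setT h -> sqdev h j @[j --> \oo] --> 0%E ->
  rigid_set [set x | a < h x].
Proof.
move=> mh /nneseq_cvg0P qh.
have mgt (b : R) : measurable [set x | b < h x].
  rewrite (_ : [set x | _] = h @^-1` `]b, +oo[); last first.
    by apply/seteqP; split => x /=; rewrite in_itv /= andbT.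
  by rewrite -[_ @^-1` _]setTI; exact: mh.
apply/rigid_setP => // e e0.
(* These strips decrease to the empty set, so one of them has measure at most [e / 4]. *)
pose C n := [set x | a < h x] `\` [set x | a + n.+1%:R^-1 < h x].
have mC n : measurable (C n) by exact: measurableD.
have : mu (C n) @[n --> \oo] --> 0%E.
  have C0 : \bigcap_n C n = set0.
    apply/seteqP; split => // x xC; have [ax _] := xC 0%N I.
    have hx0 : 0 < h x - a by rewrite subr_gt0.
    have [n _ /(_ n (leqnn n)) nh] := near_infty_natSinv_lt (PosNum hx0).
    have [_ /=] := xC n I; apply; rewrite -ltrBrDl; exact: nh.
  rewrite -(measure0 mu) -C0; apply: nonincreasing_cvg_mu => //.
  - by rewrite (le_lt_trans (probability_le1 _ _)) ?ltry.
  - by rewrite C0.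
  - move=> m n mn; apply/subsetPset => x /= [ax nx]; split => //.
    apply: contra_not nx => mx; apply: le_lt_trans mx.
    by rewrite lerD2l lef_pV2 ?posrE ?ltr0n // ler_nat ltnS.
have e40 : 0 < e / 4 by rewrite divr_gt0.
move=> /nneseq_cvg0P /(_ _ e40) [] // n _ /(_ n (leqnn n)) /= Cn.
pose dl : R := n.+1%:R^-1.
have dl0 : 0 < dl by rewrite invr_gt0 ltr0n.
near=> j.
have qj : (sqdev h j <= (dl ^+ 2 * (e / 4))%:E)%E.
  by near: j; apply: qh; [exact: sqdev_ge0|rewrite mulr_gt0 // exprn_gt0].
have mdev : measurable_fun setT (fun x => h (t j x) - h x).
  by apply: measurable_funB => //; exact: measurableT_comp.
have mD : measurable [set x | dl <= `|h (t j x) - h x|].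
  rewrite (_ : [set x | _] = (fun x => `|h (t j x) - h x|) @^-1` `[dl, +oo[).
    rewrite -[_ @^-1` _]setTI; apply: measurableT_comp => //.
  by apply/seteqP; split => x /=; rewrite in_itv /= andbT.
have muD : (mu [set x | (dl <= `|h (t j x) - h x|)%R] <= (e / 4)%:E)%E.
  have := le_trans (ge0_sqr_chebyshev dl0 mdev) qj.
  rewrite (EFinM (dl ^+ 2)) lee_pmul2l //; last by rewrite lte_fin exprn_gt0.
set B := [set x | a < h x].
have mtB := measurable_preim j (mgt a).
have BtB : (mu (B `\` t j @^-1` B) <= (e / 2)%:E)%E.
  rewrite (_ : e / 2 = e / 4 + e / 4); last by field.
  rewrite EFinD; apply: le_trans (leeD Cn muD).
  apply: le_trans (measureU2 _ (mC n) mD).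
  apply: le_measure; rewrite ?inE.
  - by apply: measurableD => //; exact: mgt.
  - exact: measurableU.
  move=> x [/= Bx /negP]; rewrite -leNgt => tBx.
  have [lx|lx] := leP (h x) (a + dl).
    by left; split => //=; apply/negP; rewrite -leNgt.
  right; rewrite /= distrC ger0_norm; lra.
(* By invariance both one-sided differences have measure [mu B] minus that of the intersection, so
   the bound just proved carries over. *)
have tBB : (mu (t j @^-1` B `\` B) <= (e / 2)%:E)%E.
  have fin A : measurable A -> (mu A < +oo)%E.
    by move=> mA; rewrite (le_lt_trans (probability_le1 _ _)) ?ltry.
  rewrite measureD //; [|exact: mgt|exact: fin].
  rewrite [X in (X - _ <= _)%E](mut j (mgt a)) setIC.
  by rewrite measureD // in BtB; [exact: mgt|apply/fin/mgt].
rewrite [e]splitr EFinD; apply: le_trans (leeD tBB BtB).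
by apply: measureU2; apply: measurableD => //; exact: mgt.
Unshelve. all: by end_near. Qed.

Lemma measurable_dev (h : T -> R) j :
  measurable_fun setT h -> measurable_fun setT (fun x => h (t j x) - h x).
Proof.
by move=> mh; apply: measurable_funB => //; exact: measurableT_comp.
Qed.

Lemma measurable_sqrE (h : T -> R) :
  measurable_fun setT h -> measurable_fun setT (fun x => ((h x) ^+ 2)%:E).
Proof. by move=> mh; apply/measurable_EFinP; exact: measurable_funX. Qed.

(** The pointwise inequality is [(g - h)^2 >= 0] rearranged. It stands in for the triangle
    inequality when norms are kept squared. *)
Lemma integral_sqrD_le (g h : T -> R) :
  measurable_fun setT g -> measurable_fun setT h ->
  (\int[mu]_x ((g x + h x) ^+ 2)%:E <=
     2%:E * (\int[mu]_x ((g x) ^+ 2)%:E + \int[mu]_x ((h x) ^+ 2)%:E))%E.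
Proof.
move=> mg mh.
rewrite -ge0_integralD //;
  [|by move=> x _; rewrite lee_fin sqr_ge0|exact: measurable_sqrE
   |by move=> x _; rewrite lee_fin sqr_ge0|exact: measurable_sqrE].
rewrite -ge0_integralZl //.
- apply: ge0_le_integral => //.
  + by move=> x _; rewrite lee_fin sqr_ge0.
  + by apply: measurable_sqrE; exact: measurable_funD.
  + by apply: measurable_funeM; apply: emeasurable_funD; exact: measurable_sqrE.
  + move=> x _; rewrite -EFinD -EFinM lee_fin.
    have := sqr_ge0 (g x - h x); rewrite sqrrB sqrrD; lra.
- by apply: emeasurable_funD; exact: measurable_sqrE.
- by move=> x _; rewrite -EFinD lee_fin addr_ge0 ?sqr_ge0.
Qed.

Lemma sqdevD_le (g h : T -> R) j :
  measurable_fun setT g -> measurable_fun setT h ->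
  (sqdev (g \+ h)%R j <= 2%:E * (sqdev g j + sqdev h j))%E.
Proof.
move=> mg mh.
apply: le_trans (integral_sqrD_le (measurable_dev j mg) (measurable_dev j mh)).
rewrite /sqdev; under eq_integral do rewrite /= opprD addrACA; exact: lexx.
Qed.

(** By invariance [h \o t j] and [h] have equal squared norms, so the factor is [2 * (1 + 1)]. *)
Lemma sqdev_le_norm (h : T -> R) j : measurable_fun setT h ->
  (sqdev h j <= 4%:E * \int[mu]_x ((h x) ^+ 2)%:E)%E.
Proof.
move=> mh; have mNh : measurable_fun setT (\- h) by exact: measurableT_comp.
have := integral_sqrD_le (measurableT_comp mh (mt j)) mNh.
have -> : (\int[mu]_x ((\- h) x ^+ 2)%:E = \int[mu]_x ((h x) ^+ 2)%:E)%E.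
  by apply: eq_integral => x _; rewrite /= sqrrN.
rewrite (ge0_integral_preserving (mt j) (mut j) (measurable_sqrE mh)).
  2: by move=> x; rewrite lee_fin sqr_ge0.
rewrite -[X in (_ * (X + X))%E]mul1e -ge0_muleDl // muleA -EFinD -EFinM.
by rewrite (_ : 2 * (1 + 1) = 4 :> R) //; ring.
Qed.

Definition sqdev_vanishes (h : T -> R) : Prop :=
  sqdev h j @[j --> \oo] --> 0%E.

Lemma sqdev_vanishesP (h : T -> R) :
  sqdev_vanishes h <-> (forall e : R, 0 < e ->
    \forall j \near \oo, (sqdev h j <= e%:E)%E).
Proof. by apply: nneseq_cvg0P => n; exact: sqdev_ge0. Qed.

Lemma sqdev_vanishesD (g h : T -> R) :
  measurable_fun setT g -> measurable_fun setT h ->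
  sqdev_vanishes g -> sqdev_vanishes h -> sqdev_vanishes (g \+ h).
Proof.
move=> mg mh /sqdev_vanishesP vg /sqdev_vanishesP vh.
apply/sqdev_vanishesP => e e0; have e40 : 0 < e / 4 by rewrite divr_gt0.
near=> j; apply: le_trans (sqdevD_le _ mg mh) _.
have -> : e = 2 * (e / 4 + e / 4) by field.
rewrite EFinM lee_pmul2l // EFinD leeD //; near: j; [exact: vg|exact: vh].
Unshelve. all: by end_near. Qed.

Lemma sqdev_vanishesZ (k : R) (h : T -> R) :
  measurable_fun setT h -> sqdev_vanishes h ->
  sqdev_vanishes (fun x => k * h x).
Proof.
move=> mh vh.
have kE j : sqdev (fun x => k * h x) j = ((k ^+ 2)%:E * sqdev h j)%E.
  rewrite /sqdev -ge0_integralZl //.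
  - by apply: eq_integral => x _; rewrite -mulrBr exprMn EFinM.
  - by apply: measurable_sqrE; exact: measurable_dev.
  - by move=> x _; rewrite lee_fin sqr_ge0.
  - by rewrite lee_fin sqr_ge0.
rewrite /sqdev_vanishes; under eq_fun do rewrite kE.
by rewrite -(mule0 (k ^+ 2)%:E); apply: cvgeZl.
Qed.

(* By invariance, h |-> sqdev h j is bounded by the squared L2 norm uniformly
   in j, hence vanishing of the deviations is closed under L2 limits. *)
Lemma sqdev_vanishes_approx (h : T -> R) : measurable_fun setT h ->
  (forall e : R, 0 < e -> exists g, [/\ measurable_fun setT g,
     sqdev_vanishes g & (\int[mu]_x ((h x - g x) ^+ 2)%:E <= e%:E)%E]) ->
  sqdev_vanishes h.
Proof.
move=> mh hg; apply/sqdev_vanishesP => e e0.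
have [|g [mg /sqdev_vanishesP vg ge]] := hg (e / 16); first by rewrite divr_gt0.
have mhg : measurable_fun setT (fun x => h x - g x) by exact: measurable_funB.
near=> j.
have gj : (sqdev g j <= (e / 4)%:E)%E by near: j; apply: vg; rewrite divr_gt0.
have hgj : (sqdev (fun x => h x - g x)%R j <= (e / 4)%:E)%E.
  apply: le_trans (sqdev_le_norm _ mhg) _.
  have -> : e / 4 = 4 * (e / 16) by field.
  by rewrite EFinM lee_pmul2l.
have -> : h = g \+ (fun x => h x - g x)%R.
  by apply/funext => x /=; rewrite addrC subrK.
apply: le_trans (sqdevD_le _ mg mhg) _.
have -> : e = 2 * (e / 4 + e / 4) by field.
by rewrite EFinM lee_pmul2l // EFinD leeD.
Unshelve. all: by end_near. Qed.

(** The difference of the two indicators takes values in -1, 0, 1, and its square is the indicator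
    of the exclusive or. This links rigidity of sets with rigidity of functions. *)
Lemma sqdev_indic (B : set T) j : measurable B ->
  sqdev \1_B j = mu ((t j @^-1` B) `+` B).
Proof.
move=> mB; rewrite -[RHS]mul1e -(setIT (_ `+` _)).
rewrite -integral_indic //; last exact: measurable_preimY.
rewrite mul1e; apply: eq_integral => x _; rewrite !indicE.
have -> : (x \in (t j @^-1` B) `+` B) = (t j x \in B) (+) (x \in B).
  rewrite /setY in_setU !in_setD (_ : (x \in _ @^-1` _) = (t j x \in B)) //.
  by case: (t j x \in B); case: (x \in B).
case: (t j x \in B); case: (x \in B) => /=; congr (_%:E); ring.
Qed.

Lemma sqdev_vanishes_indic (B : set T) : rigid_set B -> sqdev_vanishes \1_B.
Proof.
move=> [mB rB]; rewrite /sqdev_vanishes.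
by under eq_fun do rewrite (sqdev_indic _ mB).
Qed.

(** * From rigid sets to square-integrable functions *)

Hypothesis all_rigid : forall B, measurable B -> rigid_set B.

Import HBNNSimple.

(** A simple function is the finite sum of its values times indicators of its fibres. The induction
    runs over an arbitrary list of values and carries measurability, which [sqdev_vanishesD] asks
    for. *)
Lemma sqdev_vanishes_nnsfun (g : {nnsfun T >-> R}) : sqdev_vanishes g.
Proof.
suff H (s : seq R) : measurable_fun setT
      (fun x => \sum_(r <- s) r * \1_(g @^-1` [set r]) x) /\
    sqdev_vanishes (fun x => \sum_(r <- s) r * \1_(g @^-1` [set r]) x).
  pose s := finmap.enum_fset (fset_set (range g)).
  rewrite (_ : (g : T -> R) = fun x => \sum_(r <- s) r * \1_(g @^-1` [set r]) x).
    by case: (H s).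
  by apply/funext => x; rewrite fimfunE fsbig_finite.
elim: s => [|r s [ms vs]].
  split; first by under eq_fun do rewrite big_nil; exact: measurable_cst.
  apply/sqdev_vanishesP => e e0; apply: nearW => j.
  rewrite /sqdev; under eq_integral do rewrite !big_nil subrr expr0n /=.
  by rewrite integral0 lee_fin ltW.
have mr : measurable_fun setT (fun x => r * \1_(g @^-1` [set r]) x : R).
  exact: measurable_funM.
have -> : (fun x => \sum_(r <- r :: s) r * \1_(g @^-1` [set r]) x) =
  (fun x => r * \1_(g @^-1` [set r]) x : R) \+
  (fun x => \sum_(r <- s) r * \1_(g @^-1` [set r]) x).
  by apply/funext => x; rewrite big_cons.
split; first exact: measurable_funD.
apply: sqdev_vanishesD => //; apply: sqdev_vanishesZ => //.
by apply: sqdev_vanishes_indic; exact: all_rigid.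
Qed.

(** The simple approximations increase to [h], so [0 <= h - g n <= h]. Dominated convergence with
    dominating function [h^2] then gives approximation in L2. *)
Lemma sqdev_vanishes_ge0 (h : T -> R) : measurable_fun setT h ->
  (forall x, 0 <= h x) -> (\int[mu]_x ((h x) ^+ 2)%:E < +oo)%E ->
  sqdev_vanishes h.
Proof.
move=> mh h0 ih.
have mhE : measurable_fun setT (EFin \o h) by exact/measurable_EFinP.
pose g := nnsfun_approx measurableT mhE.
have hE0 x : setT x -> (0 <= (EFin \o h) x)%E by rewrite lee_fin.
have gh x : (g n x : R^o) @[n --> \oo] --> (h x : R^o).
  by have /fine_cvgP [] := cvg_nnsfun_approx measurableT mhE hE0 (I : setT x).
have gleh n x : g n x <= h x.
  have ndg : nondecreasing_seq (fun n => g n x).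
    by move=> a b ab; have /lefP := nd_nnsfun_approx measurableT mhE ab; exact.
  have := nondecreasing_cvgn_le ndg (cvgP _ (gh x)) n.
  by rewrite (cvg_lim _ (gh x)).
have mdif n : measurable_fun setT (fun x => h x - g n x).
  exact: measurable_funB.
have [|||_ _] := @dominated_convergence _ _ _ mu setT measurableT
   (fun n x => ((h x - g n x) ^+ 2)%:E) (cst 0%E) (fun x => ((h x) ^+ 2)%:E)
   (fun n => measurable_sqrE (mdif n)) (measurable_cst _).
- apply: aeW => x _ /=; apply: cvg_EFin; first exact: nearW.
  rewrite (_ : 0 = (h x - h x) ^+ 2 :> R^o); last by rewrite subrr expr0n.
  apply: (@cvg_comp _ _ _ _ (fun y : R^o => y ^+ 2 : R^o)); last first.
    exact: exprn_continuous.
  by apply: cvgB => //; exact: cvg_cst.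
- apply/integrableP; split; first exact: measurable_sqrE.
  by under eq_integral do rewrite gee0_abs ?lee_fin ?sqr_ge0 //.
- apply: aeW => x n _; rewrite gee0_abs ?lee_fin ?sqr_ge0 //.
  rewrite ler_pXn2r ?nnegrE ?subr_ge0 ?gleh // ?lerBlDr ?lerDl //.
rewrite integral0 => dct; apply: sqdev_vanishes_approx => // e e0.
move/nneseq_cvg0P: dct => /(_ _ e e0).
case=> // [n|n _ /(_ n (leqnn n)) gn].
  by apply: integral_ge0 => x _; rewrite lee_fin sqr_ge0.
by exists (g n); split => //; exact: sqdev_vanishes_nnsfun.
Qed.

Lemma sqdev_vanishes_L2 (h : T -> R) : measurable_fun setT h ->
  (\int[mu]_x ((h x) ^+ 2)%:E < +oo)%E -> sqdev_vanishes h.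
Proof.
move=> mh ih.
have bnd (g : T -> R) : measurable_fun setT g -> (forall x, `|g x| <= `|h x|) ->
    (\int[mu]_x ((g x) ^+ 2)%:E < +oo)%E.
  move=> mg gh; apply: le_lt_trans ih; apply: ge0_le_integral => //.
  - by move=> x _; rewrite lee_fin sqr_ge0.
  - exact: measurable_sqrE.
  - exact: measurable_sqrE.
  - move=> x _; rewrite lee_fin -[g x ^+ 2]real_normK ?num_real //.
    by rewrite -[h x ^+ 2]real_normK ?num_real // ler_pXn2r ?nnegrE.
(* Both parts are dominated by [|h|], hence square integrable; the minus sign is written as a scalar
   to fit [sqdev_vanishesZ]. *)
have -> : h = h^\+ \+ (fun x => (- 1) * h^\- x).
  apply/funext => x; rewrite /= mulN1r.
  exact: (congr1 (@^~ x) (esym (funrposBneg h))).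
have mp : measurable_fun setT h^\+ by exact: measurable_funrpos.
have mn : measurable_fun setT h^\- by exact: measurable_funrneg.
apply: sqdev_vanishesD => //; first exact: measurable_funM.
  apply: sqdev_vanishes_ge0 => //; apply: bnd => // x.
  rewrite ger0_norm // /funrpos.
  by case: (leP (h x) 0) => [_|/ltW /ger0_norm ->].
apply: sqdev_vanishesZ => //.
apply: sqdev_vanishes_ge0 => //; apply: bnd => // x.
rewrite ger0_norm // /funrneg; case: (leP (- h x) 0) => [_|] //.
by rewrite -normrN => /ltW /ger0_norm ->.
Qed.

End measure_preserving.

(** * Complex-valued square-integrable functions *)

Lemma normcE2 (R : realType) (z : R[i]) :
  normc z ^+ 2 = complex.Re z ^+ 2 + complex.Im z ^+ 2.
Proof. by case: z => a b; rewrite /= sqr_sqrtr // addr_ge0 ?sqr_ge0. Qed.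

Lemma normc_ge0 (R : realType) (z : R[i]) : 0 <= normc z.
Proof. by case: z => a b; exact: sqrtr_ge0. Qed.

Section L2.
Context d (T : measurableType d) (R : realType) (mu : probability T R).
Implicit Types F : T -> R[i].

Lemma L2normE F : L2norm mu F =
  ((\int[mu]_x ((normc (F x)) ^+ 2)%:E) `^ 2^-1)%E.
Proof.
rewrite /L2norm unlock; congr (_ `^ _)%E; apply: eq_integral => x _ /=.
by rewrite ger0_norm ?normc_ge0 // powR_mulrn ?normc_ge0.
Qed.

Lemma integral_normc2 F :
  measurable_fun setT (fun x => complex.Re (F x)) ->
  measurable_fun setT (fun x => complex.Im (F x)) ->
  (\int[mu]_x ((normc (F x)) ^+ 2)%:E =
   \int[mu]_x ((complex.Re (F x)) ^+ 2)%:E +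
   \int[mu]_x ((complex.Im (F x)) ^+ 2)%:E)%E.
Proof.
move=> mRe mIm; rewrite -ge0_integralD //.
- by apply: eq_integral => x _; rewrite normcE2 EFinD.
- by move=> x _; rewrite lee_fin sqr_ge0.
- exact: measurable_sqrE.
- by move=> x _; rewrite lee_fin sqr_ge0.
- exact: measurable_sqrE.
Qed.

(** Squaring and taking roots are monotone on nonnegative extended reals, so a bound by [e] for one
    sequence comes from a bound by the root or the square of [e] for the other. *)
Lemma cvg0_sqrte (u : nat -> \bar R) : (forall n, (0 <= u n)%E) ->
  ((u n) `^ 2^-1)%E @[n --> \oo] --> 0%E <-> u n @[n --> \oo] --> 0%E.
Proof.
move=> u0; have s0 n : (0 <= u n `^ 2^-1)%E by exact: poweR_ge0.
have sE n : u n = ((u n `^ 2^-1) `^ 2)%E.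
  by rewrite -poweRrM mulVf // poweRe1.
have mono r (x y : \bar R) : 0 <= r -> (0 <= x)%E -> (x <= y)%E ->
    (x `^ r <= y `^ r)%E.
  move=> r0 x0 xy; apply: gt0_ler_poweR => //; rewrite in_itv /= leey andbT //.
  exact: le_trans xy.
split=> /nneseq_cvg0P uc; apply/nneseq_cvg0P => // e e0.
  near=> n; rewrite sE; have -> : e%:E = ((Num.sqrt e)%:E `^ 2)%E.
    by rewrite /= powR_mulrn ?sqrtr_ge0 // sqr_sqrtr // ltW.
  apply: mono => //; near: n; apply: uc => //; by rewrite sqrtr_gt0.
near=> n; have -> : e%:E = ((e ^+ 2)%:E `^ 2^-1)%E.
  by rewrite /= -powR_mulrn ?ltW // -powRrM mulfV // powRr1 // ltW.
apply: mono => //; near: n; apply: uc => //; exact: exprn_gt0.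
Unshelve. all: by end_near. Qed.

Variables (s : T -> T) (ms : measurable_fun setT s).
Hypothesis mus : invariant_measure mu s.
Variable n_ : nat -> nat.
Let t j := iter (n_ j) s.

Lemma measurable_iter k : measurable_fun setT (iter k s).
Proof.
elim: k => [|k IHk]; first exact: measurable_id.
exact: (measurableT_comp ms IHk).
Qed.

Lemma invariant_iter k (B : set T) :
  measurable B -> mu (iter k s @^-1` B) = mu B.
Proof.
elim: k B => [|k IHk] B mB //.
have -> : iter k.+1 s @^-1` B = iter k s @^-1` (s @^-1` B).
  by apply/funext => x; rewrite /preimage /=.
rewrite IHk; first exact: mus.
by rewrite -[_ @^-1` _]setTI; exact: ms.
Qed.

(** Both directions pass through [sqdev]: indicators recover the sets, and a general function is
    treated through its real and imaginary parts. *)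
Lemma L2_rigid_alongP :
  L2_rigid_along mu s n_ <-> set_rigid_along mu s n_.
Proof.
have mt j : measurable_fun setT (t j) by exact: measurable_iter.
have mut j (B : set T) : measurable B -> mu (t j @^-1` B) = mu B.
  exact: invariant_iter.
have devE F j : measurable_fun setT (fun x => complex.Re (F x)) ->
  measurable_fun setT (fun x => complex.Im (F x)) ->
  L2norm mu (fun x => F (iter (n_ j) s x) - F x) =
  ((sqdev mu t (fun x => complex.Re (F x)) j +
    sqdev mu t (fun x => complex.Im (F x)) j) `^ 2^-1)%E.
  move=> mRe mIm; rewrite L2normE integral_normc2.
  - rewrite /sqdev; congr ((_ + _) `^ _)%E; apply: eq_integral => x _;
    by rewrite /t; case: (F _) => ? ?; case: (F _).
  - rewrite (_ : (fun x => _) =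
        fun x => complex.Re (F (t j x)) - complex.Re (F x)).
      exact: measurable_dev.
    by apply/funext => x; rewrite /t; case: (F _) => ? ?; case: (F _).
  - rewrite (_ : (fun x => _) =
        fun x => complex.Im (F (t j x)) - complex.Im (F x)).
      exact: measurable_dev.
    by apply/funext => x; rewrite /t; case: (F _) => ? ?; case: (F _).
split=> [L2r B mB|setr F [mRe mIm LF]].
  pose F x : R[i] := (\1_B x)%:C%C.
  have mRe : measurable_fun setT (fun x => complex.Re (F x)).
    exact: measurable_indic.
  have mIm : measurable_fun setT (fun x => complex.Im (F x)).
    exact: measurable_cst.
  have LF : L2 mu F.
    split=> //; rewrite L2normE poweR_lty // integral_normc2 //=.
    under [X in (_ + X)%E]eq_integral do rewrite expr0n /=.
    rewrite integral0 adde0.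
    under eq_integral do rewrite indicE expr2 -natrM mulnb andbb -indicE.
    rewrite integral_indic // setIT.
    by rewrite (le_lt_trans (probability_le1 _ _)) ?ltry.
  have := L2r F LF; under eq_fun do rewrite devE //.
  move/(cvg0_sqrte (fun j => adde_ge0 (sqdev_ge0 _ _ _ _) (sqdev_ge0 _ _ _ _))).
  (* The indicator is real, so only the real part contributes. *)
  have Im0 j : sqdev mu t (fun x => complex.Im (F x)) j = 0%E.
    rewrite /sqdev; under eq_integral do rewrite /= subrr expr0n /=.
    exact: integral0.
  under eq_fun do rewrite Im0 adde0.
  by under eq_fun do rewrite (sqdev_indic mu mt _ mB).
have rB B : measurable B -> rigid_set mu t B.
  by move=> mB; split=> //; exact: setr.
have : (\int[mu]_x ((normc (F x)) ^+ 2)%:E < +oo)%E.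
  by apply: (@lty_poweRy _ _ 2^-1); rewrite ?invr_neq0 // -L2normE.
rewrite integral_normc2 // => ltF.
have LRe : (\int[mu]_x ((complex.Re (F x)) ^+ 2)%:E < +oo)%E.
  apply: le_lt_trans ltF; rewrite leeDl //.
  by apply: integral_ge0 => x _; rewrite lee_fin sqr_ge0.
have LIm : (\int[mu]_x ((complex.Im (F x)) ^+ 2)%:E < +oo)%E.
  apply: le_lt_trans ltF; rewrite leeDr //.
  by apply: integral_ge0 => x _; rewrite lee_fin sqr_ge0.
under eq_fun do rewrite devE //.
apply/cvg0_sqrte; first by move=> j; rewrite adde_ge0 // sqdev_ge0.
rewrite -[X in _ --> X]adde0; apply: cvgeD => //.
  exact: sqdev_vanishes_L2 mt mut rB _ mRe LRe.
exact: sqdev_vanishes_L2 mt mut rB _ mIm LIm.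
Qed.

End L2.

(** * Characters of the shift algebra *)

Section shift_algebra_theory.
Context (R : realType).
Implicit Types g h : nat -> R[i].

Lemma supnorm_le g (M : R) : (forall n, normc (g n) <= M) -> supnorm g <= M.
Proof.
move=> gM; apply: ge_sup; first by exists (normc (g 0%N)), 0%N.
by move=> _ [n _ <-].
Qed.

(** Boundedness matters, since [sup] takes a default value on unbounded sets. *)
Lemma le_supnorm g n : linfty g -> normc (g n) <= supnorm g.
Proof.
move=> [M gM]; apply: ub_le_sup; last by exists n.
by exists M => _ [m _ <-].
Qed.

Lemma normc_conj (z : R[i]) : normc z^* = normc z.
Proof.
by case: z => a b; rewrite -[LHS]/(normc (Complex a (- b))) /= sqrrN.
Qed.

Lemma linftyB g h : linfty g -> linfty h -> linfty (g - h).
Proof.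
move=> [M gM] [N hN]; exists (M + N) => n.
by apply: le_trans (le_normcD (g n) (- h n)) _; rewrite normcN lerD.
Qed.

(** Makes the space of all bounded sequences a member of the family whose intersection is the
    generated algebra. *)
Lemma linfty_cstar : unital_cstar_subalgebra (@linfty R).
Proof.
split=> //.
- by exists 1 => n; rewrite normc1.
- move=> g h [M gM] [N hN]; exists (M + N) => n.
  by apply: le_trans (le_normcD _ _) _; rewrite lerD.
- move=> a g [M gM]; exists (normc a * M) => n.
  rewrite (_ : (a *: g) n = a * g n) // normcM.
  by apply: ler_wpM2l => //; exact: normc_ge0.
- move=> g h [M gM] [N hN]; exists (M * N) => n.
  rewrite (_ : (g * h) n = g n * h n) // normcM.
  by apply: ler_pM => //; exact: normc_ge0.
- by move=> g [M gM]; exists M => n; rewrite normc_conj.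
Qed.

Variable f : nat -> R[i].
Hypothesis fb : linfty f.

(** Boundedness of the elements holds because, for bounded [f], [linfty] is one of the algebras
    intersected. The closure properties pass to intersections. *)
Lemma in_shift_algebra_cstar :
  unital_cstar_subalgebra [set g | in_shift_algebra f g].
Proof.
have gen S : unital_cstar_subalgebra S ->
    [set 1] `|` shift_orbit f `<=` S -> [set g | in_shift_algebra f g] `<=` S.
  by move=> cS GS g /in_shift_algebraP; exact.
split.
- apply: gen; first exact: linfty_cstar.
  move=> g [->|[j _ <-]]; first exact: cstar_one linfty_cstar.
  have [M fM] := fb; exists M => n.
  elim: j n => [|j IHj] n //=; exact: IHj.
- by apply/in_shift_algebraP => S cS _; exact: cstar_one.
- move=> g h /in_shift_algebraP Sg /in_shift_algebraP Sh.
  apply/in_shift_algebraP => S cS GS.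
  by apply: cstar_add; [|exact: Sg|exact: Sh].
- move=> a g /in_shift_algebraP Sg.
  by apply/in_shift_algebraP => S cS GS; apply: cstar_scale; [|exact: Sg].
- move=> g h /in_shift_algebraP Sg /in_shift_algebraP Sh.
  apply/in_shift_algebraP => S cS GS.
  by apply: cstar_mul; [|exact: Sg|exact: Sh].
- move=> g /in_shift_algebraP Sg.
  by apply/in_shift_algebraP => S cS GS; apply: cstar_conj; [|exact: Sg].
- move=> g gb Sg; apply/in_shift_algebraP => S cS GS; apply: cstar_closed => //.
  by move=> e /Sg [h /in_shift_algebraP Sh he]; exists h => //; exact: Sh.
Qed.

Lemma seq_of_bounded (g : shift_algebra f) : linfty (seq_of g).
Proof. exact: (cstar_bounded in_shift_algebra_cstar) (seq_ofP g). Qed.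

Lemma in_shift_algebra_limit g :
  (forall e : R, 0 < e -> exists h : shift_algebra f,
     forall n, normc (g n - seq_of h n) <= e) -> in_shift_algebra f g.
Proof.
move=> gh; apply: (cstar_closed in_shift_algebra_cstar) => [|e e0].
  (* [cstar_closed] asks for a bounded limit; the approximant at distance 1 supplies the bound. *)
  have [h gh1] := gh 1 ltr01; have [M hM] := seq_of_bounded h.
  exists (1 + M) => n; rewrite -[g n](subrK (seq_of h n)).
  by apply: le_trans (le_normcD _ _) _; rewrite lerD.
have [|h ghe] := gh (e / 2); first by rewrite divr_gt0.
exists (seq_of h); first exact: seq_ofP.
apply: le_lt_trans (supnorm_le ghe) _.
by rewrite ltr_pdivrMr // ltr_pMr // ltr1n.
Qed.

Definition conj_alg (g : shift_algebra f) : shift_algebra f :=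
  ShiftAlgebra (cstar_conj in_shift_algebra_cstar (seq_ofP g)).

Fact in_shift_algebra_orbit j : in_shift_algebra f (iter j (@Defs.shift R) f).
Proof. by apply/in_shift_algebraP => S _; apply; right; exists j. Qed.

Definition orbit_alg j : shift_algebra f :=
  ShiftAlgebra (in_shift_algebra_orbit j).

Lemma seq_ofX (g : shift_algebra f) k n : seq_of (g ^+ k) n = seq_of g n ^+ k.
Proof. by elim: k => [|k IHk]; rewrite ?expr0 // !exprS -IHk. Qed.

(* Neumann series: the partial sums of the powers of g converge uniformly. *)
Lemma shift_algebra_1subr_inv (g : shift_algebra f) (r : R) : r < 1 ->
  (forall n, normc (seq_of g n) <= r) ->
  exists k : shift_algebra f, (1 - g) * k = 1.
Proof.
move=> r1 gr; have r0 : 0 <= r by exact: le_trans (normc_ge0 _) (gr 0%N).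
have d0 n : 1 - seq_of g n != 0.
  apply/eqP => /subr0_eq g1; have := gr n.
  by rewrite -g1 normc1 leNgt r1.
have dr n : 1 - r <= normc (1 - seq_of g n).
  rewrite lerBlDr; apply: le_trans (lerD (lexx _) (gr n)).
  by apply: le_trans (le_normcD _ _); rewrite subrK normc1.
pose k n := (1 - seq_of g n)^-1.
suff kA : in_shift_algebra f k.
  exists (ShiftAlgebra kA); apply: val_inj; apply/funext => n.
  exact: mulfV (d0 n).
apply: in_shift_algebra_limit => e e0.
have : (r ^+ N : R^o) @[N --> \oo] --> (0 : R^o).
  by apply: cvg_expr; rewrite ger0_norm.
(* The remainder of the geometric series is [g ^+ N / (1 - g)], of modulus at most
   [r ^+ N / (1 - r)]; this tolerance brings it below [e]. *)
move=> /cvgrPdist_lt /(_ (e * (1 - r))) [|N _ /(_ N (leqnn N))].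
  by rewrite mulr_gt0 // subr_gt0.
rewrite /= sub0r normrN ger0_norm ?exprn_ge0 // => rN.
exists (\sum_(i < N) g ^+ i) => n.
have sumE : (1 - seq_of g n) * seq_of (\sum_(i < N) g ^+ i) n =
    1 - seq_of g n ^+ N.
  have := congr1 (fun h : shift_algebra f => seq_of h n) (subrX1 g N).
  rewrite -[X in X = _ -> _]/(seq_of (g ^+ N) n - 1).
  rewrite -[X in _ = X -> _]/((seq_of g n - 1) *
    seq_of (\sum_(i < N) g ^+ i) n).
  by rewrite seq_ofX => H; rewrite -opprB mulNr -H opprB.
have -> : k n - seq_of (\sum_(i < N) g ^+ i) n =
    seq_of g n ^+ N / (1 - seq_of g n).
  apply: (mulfI (d0 n)); rewrite mulrBr sumE /k mulfV ?d0 //.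
  by rewrite mulrCA mulfV ?d0 // mulr1 opprB addrC subrK.
rewrite normcM normcV ler_pdivrMr; last first.
  by apply: lt_le_trans (dr n); rewrite subr_gt0.
have nX : normc (seq_of g n ^+ N) <= r ^+ N.
  elim: N {rN sumE} => [|N IHN]; first by rewrite !expr0 normc1.
  by rewrite !exprS normcM ler_pM // normc_ge0.
apply: le_trans nX (le_trans (ltW rN) _).
by rewrite ler_wpM2l // ltW.
Qed.

Section character.
Variable rho : spectrum f.

Lemma eval_charD (g h : shift_algebra f) :
  eval_char rho (g + h) = eval_char rho g + eval_char rho h.
Proof.
have [rhoL _ _] := set_valP rho.
by have := rhoL 1 g h; rewrite !scale1r.
Qed.

Lemma eval_charZ (a : R[i]) (g : shift_algebra f) :
  eval_char rho (a *: g) = a * eval_char rho g.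
Proof.
have [rhoL _ _] := set_valP rho.
have e0 : eval_char rho 0 = 0.
  by apply: (addrI (eval_char rho 0)); rewrite -eval_charD !addr0.
have H : eval_char rho (a *: g + 0) = a * eval_char rho g + eval_char rho 0.
  exact: rhoL.
by rewrite addr0 e0 addr0 in H.
Qed.

Lemma eval_charB (g h : shift_algebra f) :
  eval_char rho (g - h) = eval_char rho g - eval_char rho h.
Proof. by rewrite eval_charD -scaleN1r eval_charZ mulN1r. Qed.

Lemma eval_charM (g h : shift_algebra f) :
  eval_char rho (g * h) = eval_char rho g * eval_char rho h.
Proof. by have [_ rhoM _] := set_valP rho; exact: rhoM. Qed.

Lemma eval_char1 : eval_char rho 1 = 1.
Proof.
have [_ rhoM [g rhog]] := set_valP rho.
by apply: (mulIf rhog); rewrite mul1r -[LHS]rhoM mul1r.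
Qed.

(** Characters are contractive: if [|rho g| > M], then [g / rho g] has norm below 1, so
    [1 - g / rho g] is invertible, although [rho] sends it to 0. *)
Lemma eval_char_le (g : shift_algebra f) (M : R) :
  (forall n, normc (seq_of g n) <= M) -> normc (eval_char rho g) <= M.
Proof.
move=> gM; rewrite leNgt; apply/negP => Mg.
have M0 : 0 <= M by exact: le_trans (normc_ge0 _) (gM 0%N).
have g0 : 0 < normc (eval_char rho g) by exact: le_lt_trans Mg.
have rg0 : eval_char rho g != 0.
  by apply/eqP => rg; move: g0; rewrite rg normc0 ltxx.
have [] := @shift_algebra_1subr_inv ((eval_char rho g)^-1 *: g)
  (M / normc (eval_char rho g)).
- by rewrite ltr_pdivrMr // mul1r.
- move=> n; rewrite (_ : seq_of _ n = (eval_char rho g)^-1 * seq_of g n) //.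
  by rewrite normcM normcV mulrC ler_wpM2r // invr_ge0 ltW.
move=> k /(congr1 (eval_char rho)); rewrite eval_charM eval_charB eval_charZ.
by rewrite mulVf // eval_char1 subrr mul0r => /esym/eqP; rewrite oner_eq0.
Qed.

(* Arens' trick: |rho (g + i t)| is at most the norm of g + i t for all real t. *)
Lemma eval_char_real (g : shift_algebra f) :
  (forall n, complex.Im (seq_of g n) = 0) -> complex.Im (eval_char rho g) = 0.
Proof.
move=> gR; have [M gM] := seq_of_bounded g; apply/eqP/negPn/negP => b0.
set a := complex.Re (eval_char rho g); set b := complex.Im (eval_char rho g).
(* The bound reads [a^2 + (b + t)^2 <= M^2 + t^2]; choosing [2 b t = M^2 + 1] makes it fail. *)
pose t : R := (M ^+ 2 + 1) / (2 * b).
have := @eval_char_le (g + (Complex 0 t *: (1 : shift_algebra f)))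
  (Num.sqrt (M ^+ 2 + t ^+ 2)).
rewrite eval_charD eval_charZ eval_char1 mulr1 => H.
have : normc (eval_char rho g + Complex 0 t) <= Num.sqrt (M ^+ 2 + t ^+ 2).
  apply: H => n; rewrite (_ : seq_of _ n = seq_of g n + Complex 0 t); last first.
    by rewrite -[X in _ = _ + X]mulr1.
  have := gM n; have := gR n; case: (seq_of g n) => x y /= ->.
  rewrite expr0n addr0 sqrtr_sqr addr0 add0r => xM.
  rewrite ler_sqrt ?addr_ge0 ?sqr_ge0 // lerD2r -(real_normK (num_real x)).
  by rewrite ler_pXn2r ?nnegrE ?normr_ge0 // (le_trans _ xM).
have -> : eval_char rho g = Complex a b.
  by rewrite /a /b; case: (eval_char rho g).
rewrite /= addr0 ler_sqrt ?addr_ge0 ?sqr_ge0 //.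
have tb : t * b * 2 = M ^+ 2 + 1 by rewrite /t; field; exact: b0.
have := sqr_ge0 a; have := sqr_ge0 b; rewrite sqrrD.
move: (a ^+ 2) (b ^+ 2) (t ^+ 2) tb => a2 b2 t2; lra.
Qed.

(** Write [g = u + i v] with real sequences [u] and [v] in the algebra; characters take real values
    on both. *)
Lemma eval_char_conj (g : shift_algebra f) :
  eval_char rho (conj_alg g) = (eval_char rho g)^*.
Proof.
pose u : shift_algebra f := Complex 2^-1 0 *: (g + conj_alg g).
(* The scalar is [1 / (2 i)]. *)
pose v : shift_algebra f := Complex 0 (- 2^-1) *: (g - conj_alg g).
have uE n : seq_of u n = Complex (complex.Re (seq_of g n)) 0.
  rewrite -[LHS]/(Complex 2^-1 0 * (seq_of g n + (seq_of g n)^*)).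
  case: (seq_of g n) => x y; rewrite -[(Complex x y)^*]/(Complex x (- y)).
  by apply/eqP; rewrite eq_complex /=; apply/andP; split; apply/eqP; lra.
have vE n : seq_of v n = Complex (complex.Im (seq_of g n)) 0.
  rewrite -[LHS]/(Complex 0 (- 2^-1) * (seq_of g n - (seq_of g n)^*)).
  case: (seq_of g n) => x y; rewrite -[(Complex x y)^*]/(Complex x (- y)).
  by apply/eqP; rewrite eq_complex /=; apply/andP; split; apply/eqP; lra.
have gE : g = u + (Complex 0 1 *: v : shift_algebra f).
  apply: val_inj; apply/funext => n.
  rewrite -[LHS]/(seq_of g n) -[RHS]/(seq_of u n + Complex 0 1 * seq_of v n).
  rewrite uE vE.
  case: (seq_of g n) => x y.
  by apply/eqP; rewrite eq_complex /=; apply/andP; split; apply/eqP; lra.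
have cE : conj_alg g = u - (Complex 0 1 *: v : shift_algebra f).
  apply: val_inj; apply/funext => n.
  rewrite -[LHS]/((seq_of g n)^*) -[RHS]/(seq_of u n - Complex 0 1 * seq_of v n).
  rewrite uE vE.
  case: (seq_of g n) => x y; rewrite -[(Complex x y)^*]/(Complex x (- y)).
  by apply/eqP; rewrite eq_complex /=; apply/andP; split; apply/eqP; lra.
have uR : complex.Im (eval_char rho u) = 0.
  by apply: eval_char_real => n; rewrite uE.
have vR : complex.Im (eval_char rho v) = 0.
  by apply: eval_char_real => n; rewrite vE.
clearbody u v; rewrite cE [in RHS]gE eval_charB eval_charD !eval_charZ.
move: uR vR; case: (eval_char rho u) => a b /= ->.
case: (eval_char rho v) => c e /= ->.
rewrite -[RHS]/(conjc _) /=.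
by apply/eqP; rewrite eq_complex /=; apply/andP; split; apply/eqP; lra.
Qed.

End character.

End shift_algebra_theory.

(** * Borel sets of the spectrum *)

Section spectrum_topology.
Context (R : realType) (f : nat -> R[i]).
Hypothesis fb : linfty f.
Local Notation X := (spectrum f).

(* The index (i, im, neg) stands for +- Re or +- Im of the Gelfand transform of
   A^i f. *)
Definition char_coord (c : nat * bool * bool) (rho : X) : R :=
  let: (i, im, neg) := c in
  let z := eval_char rho (orbit_alg f i) in
  (-1) ^+ neg * (if im then complex.Im z else complex.Re z).

(** Finite lists with rational thresholds keep the family countable; concatenating lists gives
    intersections. *)
Definition basic_set (s : seq (nat * bool * bool * rat)) : set X :=
  [set rho | forall c, c \in s -> ratr c.2 < char_coord c.1 rho].

Definition basic_nbhs (rho : X) : set_system X :=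
  filter_from [set s | basic_set s rho] basic_set.

Global Instance basic_nbhs_filter rho : Filter (basic_nbhs rho).
Proof.
apply: filter_from_filter; first by exists [::].
move=> s1 s2 h1 h2; exists (s1 ++ s2).
  by move=> c; rewrite mem_cat => /orP[/h1|/h2].
by move=> x hx; split => c cs; apply: hx; rewrite mem_cat cs ?orbT.
Qed.

(** A rational strictly between the two values gives the basic set. Lower bounds suffice, since
    upper ones come from the coordinate of opposite sign. *)
Lemma coord_near c rho (e : R) : 0 < e ->
  \forall rho' \near basic_nbhs rho, char_coord c rho - e < char_coord c rho'.
Proof.
move=> e0; have /rat_in_itvoo [q] : char_coord c rho - e < char_coord c rho.
  by rewrite ltrBlDr ltrDl.
rewrite in_itv /= => /andP[q1 q2].
exists [:: (c, q)]; first by move=> c'; rewrite inE => /eqP ->.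
by move=> x /(_ (c, q)) /= qx; apply: lt_trans q1 _; apply: qx; rewrite inE.
Qed.

Lemma normc_le_sum (z : R[i]) :
  normc z <= `|complex.Re z| + `|complex.Im z|.
Proof.
case: z => a b /=; rewrite -[leRHS]ger0_norm ?addr_ge0 // -sqrtr_sqr.
rewrite ler_sqrt ?sqr_ge0 // sqrrD !real_normK ?num_real //.
by rewrite addrAC lerDl mulrn_wge0 // mulr_ge0.
Qed.

(** Continuity of the Gelfand transform of [g] for the filters [basic_nbhs], before these are
    compared with the weak-* topology. *)
Definition char_near (g : shift_algebra f) : Prop :=
  forall rho (e : R), 0 < e -> \forall rho' \near basic_nbhs rho,
    normc (eval_char rho' g - eval_char rho g) < e.

Lemma char_near_orbit i : char_near (orbit_alg f i).
Proof.
move=> rho e e0; have e20 : 0 < e / 2 by rewrite divr_gt0.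
near=> rho'; apply: le_lt_trans (normc_le_sum _) _.
have rr : char_coord (i, false, false) rho - e / 2 <
    char_coord (i, false, false) rho'.
  by near: rho'; exact: coord_near.
have rl : char_coord (i, false, true) rho - e / 2 <
    char_coord (i, false, true) rho'.
  by near: rho'; exact: coord_near.
have ir : char_coord (i, true, false) rho - e / 2 <
    char_coord (i, true, false) rho'.
  by near: rho'; exact: coord_near.
have il : char_coord (i, true, true) rho - e / 2 <
    char_coord (i, true, true) rho'.
  by near: rho'; exact: coord_near.
move: rr rl ir il; rewrite /char_coord.
case: (eval_char rho _) => a b; case: (eval_char rho' _) => a' b' /=.
rewrite !expr0 !expr1 !mul1r !mulN1r => rr rl ir il.
rewrite [e]splitr; apply: ltrD; rewrite ltr_norml; apply/andP; split; lra.
Unshelve. all: by end_near. Qed.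

(** The elements with this property form a unital C*-subalgebra that contains 1 and the orbit of
    [f], hence they are the whole generated algebra. *)
Lemma char_near_all (g : shift_algebra f) : char_near g.
Proof.
pose S := [set g0 : nat -> R[i] | exists2 g : shift_algebra f,
  seq_of g = g0 & char_near g].
have Sg g0 : in_shift_algebra f g0 -> S g0.
  move=> /in_shift_algebraP; apply; last first.
    move=> h [->|[j _ <-]].
      exists 1 => // rho e e0; apply: nearW => rho'.
      by rewrite !eval_char1 subrr normc0.
    by exists (orbit_alg f j) => //; exact: char_near_orbit.
  split.
  - by move=> _ [h <- _]; exact: seq_of_bounded.
  - exists 1 => // rho e e0; apply: nearW => rho'.
    by rewrite !eval_char1 subrr normc0.
  - move=> _ _ [g1 <- n1] [g2 <- n2]; exists (g1 + g2) => // rho e e0.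
    have e20 : 0 < e / 2 by rewrite divr_gt0.
    near=> rho'; rewrite !eval_charD opprD addrACA.
    apply: le_lt_trans (le_normcD _ _) _; rewrite [e]splitr.
    by apply: ltrD; near: rho'; [exact: n1|exact: n2].
  - move=> a _ [h <- nh]; exists (a *: h) => // rho e e0.
    (* Adding 1 keeps the divisor positive when [a] is 0. *)
    have a0 : 0 < normc a + 1 by rewrite ltr_wpDl ?normc_ge0.
    near=> rho'; rewrite !eval_charZ -mulrBr normcM.
    have : normc (eval_char rho' h - eval_char rho h) < e / (normc a + 1).
      by near: rho'; apply: nh; rewrite divr_gt0.
    rewrite ltr_pdivlMr // mulrC; apply: le_lt_trans.
    by rewrite ler_wpM2r ?normc_ge0 // lerDl.
  - move=> _ _ [g1 <- n1] [g2 <- n2]; exists (g1 * g2) => // rho e e0.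
    have [M gM] := seq_of_bounded fb g1; have [N gN] := seq_of_bounded fb g2.
    have M0 : 0 <= M by exact: le_trans (normc_ge0 _) (gM 0%N).
    have N0 : 0 <= N by exact: le_trans (normc_ge0 _) (gN 0%N).
    (* If each factor moves by at most [d], the product moves by at most [d * (M + N)]; the extra 1
       makes the final bound strict. *)
    have MN0 : 0 < M + N + 1 by rewrite ltr_wpDl // addr_ge0.
    have d0 : 0 < e / (M + N + 1) by rewrite divr_gt0.
    near=> rho'; rewrite !eval_charM.
    have -> (a b c d : R[i]) : a * b - c * d = (a - c) * b + c * (b - d).
      by ring.
    apply: le_lt_trans (le_normcD _ _) _.
    rewrite !normcM.
    have b1 : normc (eval_char rho' g1 - eval_char rho g1) < e / (M + N + 1).
      by near: rho'; exact: n1.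
    have b2 : normc (eval_char rho' g2 - eval_char rho g2) < e / (M + N + 1).
      by near: rho'; exact: n2.
    apply: (@le_lt_trans _ _ (e / (M + N + 1) * N + M * (e / (M + N + 1)))).
      apply: lerD; apply: ler_pM; rewrite ?normc_ge0 // ?(ltW b1) ?(ltW b2) //.
        exact: eval_char_le.
      exact: eval_char_le.
    rewrite (mulrC M) -mulrDr -mulrA mulrC -ltr_pdivlMr //.
    rewrite mulfV ?gt_eqF //.
    rewrite mulrC ltr_pdivrMr // mul1r; lra.
  - move=> _ [h <- nh]; exists (conj_alg fb h) => // rho e e0.
    near=> rho'; rewrite !eval_char_conj -rmorphB normc_conj.
    by near: rho'; exact: nh.
  - move=> g1 g1b Hg; have cl := in_shift_algebra_limit fb.
    have g1A : in_shift_algebra f g1.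
      apply: cl => e /Hg [_ [h <- _] he]; exists h => n.
      apply: le_trans (le_supnorm n _) (ltW he).
      by apply: linftyB => //; exact: seq_of_bounded.
    exists (ShiftAlgebra g1A) => // rho e e0.
    have e30 : 0 < e / 3 by rewrite divr_gt0.
    have [_ [h <- nh] he] := Hg _ e30.
    (* Contractivity makes this bound uniform in the character, as the three-epsilon argument
       requires. *)
    have hle rho' : normc (eval_char rho' (ShiftAlgebra g1A - h)) <= e / 3.
      apply: eval_char_le => // n.
      apply: le_trans (le_supnorm n _) (ltW he).
      by apply: linftyB => //; exact: seq_of_bounded.
    near=> rho'.
    have -> : eval_char rho' (ShiftAlgebra g1A) -
        eval_char rho (ShiftAlgebra g1A) =
      eval_char rho' (ShiftAlgebra g1A - h) -
        eval_char rho (ShiftAlgebra g1A - h) +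
      (eval_char rho' h - eval_char rho h).
      by rewrite !eval_charB; ring.
    apply: le_lt_trans (le_normcD _ _) _.
    have -> : e = (e / 3 + e / 3) + e / 3 by field.
    apply: ler_ltD; last by near: rho'; exact: nh.
    apply: le_trans (le_normcD _ _) _; rewrite normcN.
    by apply: lerD.
have [h hg nh] := Sg _ (seq_ofP g).
by rewrite (_ : g = h) //; exact: val_inj.
Unshelve. all: by end_near. Qed.

(** Balls of [R[i]^o] have radii in [R[i]]; a positive one has zero imaginary part and so is a real
    radius. *)
Lemma near_char_ball (z : R[i]) (A : set R[i]) : nbhs (z : R[i]^o) A ->
  exists2 e : R, 0 < e & forall w, normc (w - z) < e -> A w.
Proof.
move=> [e /= e0 eA].
have eE : e = Complex (complex.Re e) 0.
  by have := gtr0_real e0 => /RRe_real <-.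
exists (complex.Re e); first by move: e0; rewrite eE ltcE /= => /andP[].
move=> w wz; apply: eA => /=; rewrite eE distrC normc_def ltcE /= eqxx /=.
by case: (w - z) wz.
Qed.

Lemma nbhs_normc_ball (z : R[i]) (e : R) : 0 < e ->
  nbhs (z : R[i]^o) [set w | normc (w - z) < e].
Proof.
move=> e0; apply/nbhs_ballP; exists (Complex e 0).
  by rewrite /= ltcE /= eqxx.
move=> w; rewrite /ball /= distrC normc_def ltcE /= eqxx /=.
by case: (w - z).
Qed.

Lemma continuous_nbhs (T U : topologicalType) (h : T -> U) (x : T) (A : set U) :
  {for x, continuous h} -> nbhs (h x) A -> nbhs x (h @^-1` A).
Proof. by move=> ch; exact: ch. Qed.

(** The weak-* topology is initial for the evaluations, and [char_near_all] controls each of them by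
    finitely many coordinates. Hence the basic sets form a base. *)
Lemma basic_nbhs_cvg (rho : X) : basic_nbhs rho --> rho.
Proof.
move=> U; rewrite nbhsE => -[V [[B oB <-] Brho] VU].
apply: filterS VU _.
suff : (set_val @ basic_nbhs rho : set_system {ptws shift_algebra f -> R[i]^o})
    --> (set_val rho : {ptws shift_algebra f -> R[i]^o}).
  by apply; exact: open_nbhs_nbhs.
(* Convergence in the product topology is tested one evaluation at a time; constant functions show
   that evaluations are onto. *)
apply/cvg_sup => g; apply/cvg_image.
  by apply/seteqP; split=> // z _; exists (fun=> z).
move=> A /near_char_ball [e e0 eA].
exists ((fun h : shift_algebra f -> R[i]^o => h g) @^-1` A).
  have := @char_near_all g rho e e0; apply: filterS => rho' /eA; exact.
by apply/seteqP; split=> [z [h hA <-] //|z zA]; exists (fun=> z).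
Qed.

(** The option matches the output of [unpickle], so a union over [nat] runs through all finite
    lists. *)
Definition basic_inside (U : set X)
    (o : option (seq (nat * bool * bool * rat))) : set X :=
  if o is Some s then if `[< basic_set s `<=` U >] then basic_set s else set0
  else set0.

(** This is second countability of the spectrum; it lets a sigma-algebra, closed only under
    countable unions, reach every open set. *)
Lemma open_bigcup_basic (U : set X) :
  open U -> U = \bigcup_n basic_inside U (unpickle n).
Proof.
move=> oU; apply/seteqP; split=> [rho Urho|rho [n _]].
  have [s srho sU] : basic_nbhs rho U.
    by apply: basic_nbhs_cvg; exact: open_nbhs_nbhs.
  by exists (pickle s) => //; rewrite pickleK /basic_inside; case: asboolP.
rewrite /basic_inside; case: (unpickle n) => // s; case: asboolP => // sU.
exact: sU.
Qed.

(** Induction principle for Borel sets, serving both the measurability of [sigma] and the rigidity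
    of all Borel sets. *)
Lemma borel_spectrum_sub (S : set (set X)) : sigma_algebra setT S ->
  (forall c (a : R), S [set rho | a < char_coord c rho]) ->
  <<s @open X >> `<=` S.
Proof.
move=> sS Sc; apply: smallest_sub => // U oU; rewrite (open_bigcup_basic oU).
have [S0 SC SU] := sS.
have SI (A B : set X) : S A -> S B -> S (A `&` B).
  move=> SA SB; rewrite -[A `&` B]setCK setCI -!setTD; apply: (SC).
  pose F n : set X := if n is 0%N then setT `\` A else setT `\` B.
  have -> : setT `\` A `|` setT `\` B = \bigcup_n F n.
    apply/seteqP; split=> [x [xA|xB]|x [[|n] _ Fx]];
      by [exists 0%N|exists 1%N|left|right].
  by apply: SU => -[|n]; exact: SC.
have Sb s : S (basic_set s).
  elim: s => [|c s IHs].
    rewrite (_ : basic_set [::] = setT `\` set0); first exact: SC.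
    by apply/seteqP; split=> x //= _; split.
  rewrite (_ : basic_set (c :: s) =
      [set rho | ratr c.2 < char_coord c.1 rho] `&` basic_set s).
    exact: SI.
  apply/seteqP; split=> x /=.
    move=> H; split; first by apply: H; rewrite mem_head.
    by move=> c' cs; apply: H; rewrite inE cs orbT.
  by move=> [H1 H2] c'; rewrite inE => /predU1P[->|/H2].
have Si o : S (basic_inside U o) by case: o => //= s; case: ifP.
by apply: SU => n; exact: Si.
Qed.

Lemma eval_char_continuous (g : shift_algebra f) :
  continuous (fun rho : X => eval_char rho g : R[i]^o).
Proof.
move=> rho.
apply: (@continuous_comp X {ptws shift_algebra f -> R[i]^o} R[i]^o set_val
  (@proj _ (fun=> R[i]^o) g)); first exact: initial_continuous.
exact: (@proj_continuous (shift_algebra f) (fun=> R[i]^o) g).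
Qed.

(** The hypothesis is 1-Lipschitz continuity, stated on one side for all pairs; it covers the signed
    real and imaginary parts as well as [normc]. *)
Lemma open_char_gt (F : R[i] -> R) (g : shift_algebra f) (a : R) :
  (forall z w, F z - normc (w - z) <= F w) ->
  open [set rho : X | a < F (eval_char rho g)].
Proof.
move=> FL; rewrite openE => rho /= arho; rewrite /interior.
have := nbhs_normc_ball (eval_char rho g) (_ : 0 < F (eval_char rho g) - a).
rewrite subr_gt0 => /(_ arho) /(continuous_nbhs (@eval_char_continuous g rho)).
apply: filterS => rho'; rewrite /preimage /mkset => zw.
have := FL (eval_char rho g) (eval_char rho' g).
by move: zw; move: (normc _) => N; lra.
Qed.

Lemma measurable_char (F : R[i] -> R) (g : shift_algebra f) :
  (forall z w, F z - normc (w - z) <= F w) ->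
  measurable_fun setT (fun rho : borel_spectrum f => F (eval_char rho g)).
Proof.
move=> FL mD; apply: (measurability _ (RGenOInfty.measurableE R)) => //.
move=> _ [_ [a ->] <-]; rewrite setTI.
rewrite (_ : _ @^-1` _ = [set rho : X | a < F (eval_char rho g)]); last first.
  by apply/seteqP; split=> x /=; rewrite in_itv /= andbT.
by apply: sub_sigma_algebra; exact: open_char_gt.
Qed.

Lemma normc_lip_part (im neg : bool) (z w : R[i]) :
  let F := fun z : R[i] =>
    (-1) ^+ neg * (if im then complex.Im z else complex.Re z) in
  F z - normc (w - z) <= F w.
Proof.
have le1 (x y : R) : `|x| <= Num.sqrt (x ^+ 2 + y ^+ 2).
  by rewrite -sqrtr_sqr ler_sqrt ?lerDl ?addr_ge0 ?sqr_ge0.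
have le2 (x y : R) : `|y| <= Num.sqrt (x ^+ 2 + y ^+ 2) by rewrite addrC.
have := le1 (complex.Re (w - z)) (complex.Im (w - z)).
have := le2 (complex.Re (w - z)) (complex.Im (w - z)).
case: z w => a b [a' b'] /=.
rewrite !ler_norml => /andP[h1 h2] /andP[h3 h4].
by case: im neg => -[] /=; rewrite ?expr0 ?expr1 ?mul1r ?mulN1r; lra.
Qed.

Lemma measurable_coord c :
  measurable_fun setT (char_coord c : borel_spectrum f -> R).
Proof.
move: c => [[i im] neg]; apply: (@measurable_char (fun z : R[i] =>
  (-1) ^+ neg * (if im then complex.Im z else complex.Re z))) => z w.
exact: normc_lip_part.
Qed.

Lemma coord_sigma i im neg (rho : X) :
  char_coord (i, im, neg) (sigma rho) = char_coord (i.+1, im, neg) rho.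
Proof.
rewrite /char_coord; congr (_ * _).
have -> : eval_char (sigma rho) (orbit_alg f i) =
    eval_char rho (orbit_alg f i.+1).
  rewrite /eval_char /=; congr (set_val rho _); exact: val_inj.
by [].
Qed.

(** The sets with Borel preimage form a sigma-algebra. It contains the coordinate half-spaces, as
    [sigma] just raises the orbit index by one. *)
Lemma measurable_sigma :
  measurable_fun setT (@sigma R f : borel_spectrum f -> borel_spectrum f).
Proof.
move=> _ B mB; rewrite setTI.
pose S : set (set X) :=
  [set C | @measurable _ (borel_spectrum f) (@sigma R f @^-1` C)].
suff : <<s @open X >> `<=` S by apply.
apply: borel_spectrum_sub.
  split.
  - rewrite /S /= preimage_set0; exact: measurable0.
  - by move=> C; rewrite /S /= setTD -preimage_setC; exact: measurableC.
  - by move=> C; rewrite /S /= preimage_bigcup => mC; exact: bigcup_measurable.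
move=> [[i im] neg] a.
have -> : S [set rho | a < char_coord (i, im, neg) rho] =
    @measurable _ (borel_spectrum f)
      [set rho | a < char_coord (i.+1, im, neg) rho].
  congr (@measurable _ (borel_spectrum f) _); apply/funext => x.
  by congr (is_true (_ < _)); exact: coord_sigma.
rewrite (_ : [set rho | _] =
    char_coord (i.+1, im, neg) @^-1` `]a, +oo[); last first.
  by apply/seteqP; split=> x /=; rewrite in_itv /= andbT.
rewrite -[_ @^-1` _]setTI; exact: measurable_coord.
Qed.

End spectrum_topology.

(** * Invariant measures representing a mean state *)

Section invariant_measure_on_spectrum.
Context (R : realType) (f : nat -> R[i]).
Hypothesis fb : linfty f.
Variable nu : probability (borel_spectrum f) R.
Hypothesis nu_inv : invariant_measure nu (@sigma R f).

Let mt (n_ : nat -> nat) j :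
  measurable_fun setT
    (iter (n_ j) (@sigma R f) : borel_spectrum f -> borel_spectrum f).
Proof. by apply: measurable_iter; exact: measurable_sigma. Qed.

Let mut (n_ : nat -> nat) j (B : set (borel_spectrum f)) : measurable B ->
  nu (iter (n_ j) (@sigma R f) @^-1` B) = nu B.
Proof. exact: (invariant_iter (measurable_sigma fb) nu_inv). Qed.

Definition gelfand_sqnorm (g : shift_algebra f) : \bar R :=
  (\int[nu]_rho ((normc (eval_char rho g)) ^+ 2)%:E)%E.

Lemma measurable_gelfand_sqnorm (g : shift_algebra f) :
  measurable_fun setT
    (fun rho : borel_spectrum f => ((normc (eval_char rho g)) ^+ 2)%:E).
Proof.
apply: measurable_sqrE; apply: measurable_char => z w.
have zE : z = w + - (w - z) by rewrite opprB addrC subrK.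
rewrite lerBlDr addrC {1}zE; apply: le_trans (le_normcD _ _) _.
by rewrite normcN addrC.
Qed.

(** Contractivity bounds the integrand by a constant and [nu] has mass 1; so [fine] loses nothing
    below. *)
Lemma gelfand_sqnorm_fin (g : shift_algebra f) : gelfand_sqnorm g \is a fin_num.
Proof.
have [M gM] := seq_of_bounded fb g.
rewrite ge0_fin_numE; last first.
  by apply: integral_ge0 => rho _; rewrite lee_fin sqr_ge0.
apply: (@le_lt_trans _ _ (\int[nu]_rho (cst (M ^+ 2)%:E rho))%E).
  apply: ge0_le_integral => //.
  - by move=> rho _; rewrite lee_fin sqr_ge0.
  - exact: measurable_gelfand_sqnorm.
  - move=> rho _; rewrite lee_fin ler_pXn2r ?nnegrE ?normc_ge0 //.
      exact: eval_char_le.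
    exact: le_trans (normc_ge0 _) (gM 0%N).
by rewrite integral_cst // [X in (_ * X)%E](probability_setT nu) mule1 ltry.
Qed.

(** Characters preserve conjugation, so the integrand is the real number [|rho g|^2]. *)
Lemma complex_integral_gelfand (g : shift_algebra f) :
  complex_integral nu (gelfand (g * conj_alg fb g)) =
  Complex (fine (gelfand_sqnorm g)) 0.
Proof.
have E rho : gelfand (g * conj_alg fb g) rho =
    Complex (normc (eval_char rho g) ^+ 2) 0.
  rewrite /gelfand eval_charM eval_char_conj // normcE2.
  case: (eval_char rho g) => a b; rewrite -[(Complex a b)^*]/(Complex a (- b)).
  by apply/eqP; rewrite eq_complex /=; apply/andP; split; apply/eqP; ring.
rewrite /complex_integral; congr Complex.
  by rewrite /Rintegral /gelfand_sqnorm; under eq_integral do rewrite E.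
by rewrite /Rintegral; under eq_integral do rewrite E; rewrite integral0.
Qed.

Lemma eval_char_iter_sigma k i (rho : spectrum f) :
  eval_char (iter k (@sigma R f) rho) (orbit_alg f i) =
  eval_char rho (orbit_alg f (k + i)).
Proof.
elim: k i => [|k IHk] i //=.
rewrite addSnnS -IHk.
rewrite -[LHS]/(eval_char (iter k (@sigma R f) rho)
  (shift_alg (orbit_alg f i))).
by congr (eval_char _ _); exact: val_inj.
Qed.

Lemma sqdev_coord_le (n_ : nat -> nat) c j :
  (sqdev nu (fun j => iter (n_ j) (@sigma R f)) (char_coord c) j <=
   gelfand_sqnorm (orbit_alg f 0 - orbit_alg f (n_ j))%R)%E.
Proof.
move: c => [[i im] neg].
set t := fun j => iter (n_ j) (@sigma R f).
have mD : measurable_fun setT (fun rho : borel_spectrum f =>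
    ((char_coord (0%N, im, neg) (t j rho) -
      char_coord (0%N, im, neg) rho) ^+ 2)%:E).
  apply: measurable_sqrE; apply: measurable_funB; last exact: measurable_coord.
  exact: (measurableT_comp (measurable_coord (0%N, im, neg)) (mt n_ j)).
(* Composition with the [i]-th iterate of [sigma] commutes with [t j] and preserves [nu], which
   reduces the claim to the coordinates of [f] itself. *)
have -> : sqdev nu t (char_coord (i, im, neg)) j =
    sqdev nu t (char_coord (0%N, im, neg)) j.
  rewrite /sqdev -[RHS](ge0_integral_preserving
    (measurable_iter (measurable_sigma fb) i)
    (invariant_iter (measurable_sigma fb) nu_inv i) mD); last first.
    by move=> rho; rewrite lee_fin sqr_ge0.
  apply: eq_integral => rho _; rewrite /char_coord /t -iterD !eval_char_iter_sigma.
  by rewrite !addn0 addnC.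
apply: ge0_le_integral => //.
- by move=> rho _; rewrite lee_fin sqr_ge0.
- exact: measurable_gelfand_sqnorm.
move=> rho _; rewrite lee_fin /char_coord /t eval_char_iter_sigma addn0.
rewrite eval_charB normcE2.
case: (eval_char rho _) => a b; case: (eval_char rho _) => a' b' /=.
have := sqr_ge0 (a - a'); have := sqr_ge0 (b - b').
have -> : (a - a') ^+ 2 = (a' - a) ^+ 2 by ring.
have -> : (b - b') ^+ 2 = (b' - b) ^+ 2 by ring.
by rewrite -mulrBr exprMn sqrr_sign mul1r; case: im {mD}; lra.
Qed.

Lemma set_rigid_along_spectrum (n_ : nat -> nat) :
  gelfand_sqnorm (orbit_alg f 0 - orbit_alg f (n_ j)) @[j --> \oo] --> 0%E ->
  set_rigid_along nu (@sigma R f) n_.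
Proof.
move=> cvg0; pose t j := iter (n_ j) (@sigma R f).
suff H : <<s @open (spectrum f) >> `<=` rigid_set nu t.
  by move=> B mB; have [] := H B mB.
apply: borel_spectrum_sub => // [|c a].
  by apply: rigid_set_sigma_algebra => *; [exact: mt|exact: mut].
apply: sqdev_gt_rigid => //.
- by move=> *; exact: mt.
- by move=> *; exact: mut.
- exact: measurable_coord.
apply: (@squeeze_cvge _ _ _ _ (cst 0%E) _ _ _ _ _ cvg0); last exact: cvg_cst.
by apply: nearW => j; rewrite sqdev_ge0 sqdev_coord_le.
Qed.

Variable E : (nat -> R[i]) -> R[i].
Hypothesis nu_rep : forall g : shift_algebra f,
  E (seq_of g) = complex_integral nu (gelfand g).

(** The representation of [E] is applied to [g] times its conjugate, whose sequence is [|g n|^2];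
    squaring removes [sqrtC]. *)
Lemma mean_seminorm_gelfand (g : shift_algebra f) :
  mean_seminorm E (seq_of g) ^+ 2 = Complex (fine (gelfand_sqnorm g)) 0.
Proof.
rewrite /mean_seminorm sqrtCK -complex_integral_gelfand -nu_rep; congr (E _).
by apply/funext => n; rewrite normCK.
Qed.

Lemma cvg_gelfand_sqnorm (g_ : nat -> shift_algebra f) :
  (mean_seminorm E (seq_of (g_ j)) : R[i]^o) @[j --> \oo] --> (0 : R[i]^o) ->
  gelfand_sqnorm (g_ j) @[j --> \oo] --> 0%E.
Proof.
move=> cvg0; apply/nneseq_cvg0P.
  by move=> j; apply: integral_ge0 => rho _; rewrite lee_fin sqr_ge0.
move=> e e0; have se0 : 0 < Num.sqrt e by rewrite sqrtr_gt0.
have : \forall j \near \oo,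
    normc (mean_seminorm E (seq_of (g_ j)) - 0) < Num.sqrt e.
  exact: cvg0 (nbhs_normc_ball 0 se0).
apply: filterS => j; rewrite subr0 => nE.
rewrite -(fineK (gelfand_sqnorm_fin (g_ j))) lee_fin.
have := congr1 (@normc R) (mean_seminorm_gelfand (g_ j)).
rewrite expr2 normcM /= expr0n addr0 sqrtr_sqr => H.
apply: le_trans (ler_norm _) _; rewrite -H -[leRHS]sqr_sqrtr ?(ltW e0) // -expr2.
by apply: ltW; rewrite ltr_pXn2r ?nnegrE ?normc_ge0 ?sqrtr_ge0.
Qed.

End invariant_measure_on_spectrum.

Theorem theorem5p2 (R : realType) (f : nat -> R[i])
    (f_bounded : linfty f) (f_ap : asymptotically_periodic f)
    (E : (nat -> R[i]) -> R[i]) (E_mean : mean_state E)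
    (nu : probability (borel_spectrum f) R)
    (nu_inv : invariant_measure nu (@sigma R f))
    (nu_rep : forall g : shift_algebra f,
       E (seq_of g) = complex_integral nu (gelfand g)) :
  rigid nu (@sigma R f) /\
  (forall n_ : nat -> nat, (forall j, (0 < n_ j)%N) ->
     L2_rigid_along nu (@sigma R f) n_ <-> set_rigid_along nu (@sigma R f) n_).
Proof.
have L2P n_ := L2_rigid_alongP (measurable_sigma f_bounded) nu_inv n_.
split=> [|n_ _]; last exact: L2P.
have [n_ [n_gt0 n_cvg]] := f_ap E E_mean.
(* The sequence given by asymptotic periodicity for this very [E] works; it is enough to check Borel
   sets. *)
exists n_; split=> //; apply/L2P; apply: set_rigid_along_spectrum => //.
apply: (cvg_gelfand_sqnorm f_bounded nu_rep).
(* [f] is its own zeroth iterate, so both sides agree by computation. *)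
have sE j : seq_of (orbit_alg f 0 - orbit_alg f (n_ j)) =
    f - iter (n_ j) (@Defs.shift R) f by [].
by under eq_fun do rewrite sE.
Qed.
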